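(* Consider the single-user relay channel with direct link described in the context, with $\mathbf{h}\ne 0$ and $\mathbf{h}_r\neq 0$. Among all relaying matrices $\mathbf{F}\in\mathbb{C}^{M_r\times M_r}$ satisfying $\mathrm{tr}\left(\mathbf{F}(\mathbf{I}+P\,\mathbf{h}_r\mathbf{h}_r^H)\mathbf{F}^H\right)\le P_r$, the rate $R(\mathbf{F})$ is maximized by $$\mathbf{F}=\sqrt{\frac{P_r}{1+\|\mathbf{h}_r\|^2P}}\cdot\frac{\mathbf{h}\,\mathbf{h}_r^H}{\|\mathbf{h}\|\,\|\mathbf{h}_r\|},$$ and the maximal rate is $$\log_2\left(1+\|h_d\|^2P+\frac{\|\mathbf{h}\|^2\|\mathbf{h}_r\|^2P\,P_r}{1+\|\mathbf{h}\|^2P_r+\|\mathbf{h}_r\|^2P}\right).$$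
   Context: Data: an integer $M_r\ge 1$; vectors $\mathbf{h}_r,\mathbf{h}\in\mathbb{C}^{M_r}$ (user-to-relay channel $\mathbf{h}_r$, relay-to-receiver channel $\mathbf{h}^H$), a scalar $h_d\in\mathbb{C}$ (direct link), user power $P\ge 0$ and relay power $P_r>0$. $\|\cdot\|$ is the Euclidean norm (absolute value for scalars), $(\cdot)^H$ the conjugate transpose, $\mathbf{I}$ the identity. For a relaying matrix $\mathbf{F}\in\mathbb{C}^{M_r\times M_r}$ the rate is $$R(\mathbf{F})=\log_2\left(1+\|h_d\|^2P+\frac{\mathbf{h}^H\mathbf{F}\,(P\,\mathbf{h}_r\mathbf{h}_r^H)\,\mathbf{F}^H\mathbf{h}}{1+\mathbf{h}^H\mathbf{F}\mathbf{F}^H\mathbf{h}}\right).$$ *)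

(* Defs.v *)
From mathcomp Require Export all_boot all_order all_algebra.
From mathcomp Require Export sesquilinear spectral.
From mathcomp Require Export complex.
From mathcomp Require Export reals exp.

Set Implicit Arguments.
Unset Strict Implicit.
Unset Printing Implicit Defensive.

Import Order.TTheory GRing.Theory Num.Theory.

Local Open Scope ring_scope.
Local Open Scope complex_scope.
Local Open Scope sesquilinear_scope.

Definition log2 (R : realType) (x : R) : R := ln x / ln 2.

(* The norm that MathComp-Analysis puts on matrices is the sup norm, hence an
   explicit Euclidean norm here; [Normc.normc] is the real-valued complex modulus. *)
Definition norm2 (R : realType) (n : nat) (v : 'cV[R[i]]_n) : R :=
  Num.sqrt (\sum_(i < n) Normc.normc (v i 0) ^+ 2).

(* Reads off the scalar from a 1 x 1 product such as h^H F F^H h. *)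
Definition scalar_of (R : realType) (A : 'M[R[i]]_1) : R[i] := A 0 0.

(* The quotient is a nonnegative real complex number, so [complex.Re] is only
   the identification of the real complex numbers with R. *)
Definition rate (R : realType) (m : nat) (hr h : 'cV[R[i]]_m) (hd : R[i])
    (P : R) (F : 'M[R[i]]_m) : R :=
  log2 (1 + Normc.normc hd ^+ 2 * P +
        complex.Re (scalar_of (h^t* *m F *m (P%:C *: (hr *m hr^t*)) *m F^t* *m h)
                    / (1 + scalar_of (h^t* *m F *m F^t* *m h)))).

(* The order on R[i] is partial: z <= Pr%:C forces z to be real. The trace
   below always is, so no relaying matrix is excluded for that reason. *)
Definition power_feasible (R : realType) (m : nat) (hr : 'cV[R[i]]_m)
    (P Pr : R) (F : 'M[R[i]]_m) : Prop :=
  \tr (F *m (1%:M + P%:C *: (hr *m hr^t*)) *m F^t*) <= Pr%:C.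

Definition opt_relay (R : realType) (m : nat) (hr h : 'cV[R[i]]_m)
    (P Pr : R) : 'M[R[i]]_m :=
  (Num.sqrt (Pr / (1 + norm2 hr ^+ 2 * P)))%:C *:
    ((norm2 h * norm2 hr)%:C^-1 *: (h *m hr^t*)).

(* Main.v *)
(** Put a = |F^H h|^2, x = |h^H F h_r|^2, G = |h_r|^2 and H = |h|^2, so that the
    quotient in the rate is P x / (1 + a). Cauchy-Schwarz gives x <= a G and
    x <= H |F h_r|^2, and, column by column, a <= H tr(F F^H); the power
    constraint tr(F F^H) + P |F h_r|^2 <= P_r then yields a + P x <= H P_r.
    These two linear constraints on (a, x) already imply the optimal bound, and
    for F proportional to h h_r^H all the inequalities are equalities. *)
Require Import Defs.
From mathcomp Require Import ring lra.

Set Implicit Arguments.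
Unset Strict Implicit.
Unset Printing Implicit Defensive.

Import Order.TTheory GRing.Theory Num.Theory.

Local Open Scope ring_scope.
Local Open Scope complex_scope.
Local Open Scope sesquilinear_scope.

Section ConjugateTranspose.
Variable C : numClosedFieldType.

Lemma adjmxM m n p (A : 'M[C]_(m, n)) (B : 'M[C]_(n, p)) :
  (A *m B)^t* = B^t* *m A^t*.
Proof. by rewrite trmx_mul map_mxM. Qed.

Lemma adjmxK m n (A : 'M[C]_(m, n)) : A^t*^t* = A.
Proof. by apply/matrixP => i j; rewrite !mxE /= conjCK. Qed.

Lemma adjmxZ m n (a : C) (A : 'M[C]_(m, n)) : (a *: A)^t* = Num.conj a *: A^t*.
Proof. by apply/matrixP => i j; rewrite !mxE rmorphM. Qed.

End ConjugateTranspose.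

Section RelayChannel.
Variable R : realType.
Implicit Types (n : nat) (x y P Pr : R) (z : R[i]).

Lemma mulC_conj z : z * Num.conj z = (Normc.normc z ^+ 2)%:C.
Proof. by rewrite -normCK rmorphXn. Qed.

Lemma conjC_real x : Num.conj x%:C = x%:C :> R[i].
Proof. by rewrite conj_Creal // complex_real. Qed.

Lemma normc_real x : Normc.normc x%:C ^+ 2 = x ^+ 2.
Proof. by rewrite /= expr0n /= addr0 sqrtr_sqr real_normK ?num_real. Qed.

Lemma normc_conj z : Normc.normc (Num.conj z) = Normc.normc z.
Proof. by case: z => a b /=; rewrite sqrrN. Qed.

Lemma scalar_mx11E z : (z%:M : 'M_1) 0 0 = z.
Proof. by rewrite mxE mulr1n. Qed.

Lemma sqr_norm2 n (v : 'cV[R[i]]_n) :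
  norm2 v ^+ 2 = \sum_(i < n) Normc.normc (v i 0) ^+ 2.
Proof. by rewrite sqr_sqrtr // sumr_ge0 // => i _; rewrite sqr_ge0. Qed.

Lemma adjmx_mul_norm2 n (v : 'cV[R[i]]_n) : v^t* *m v = (norm2 v ^+ 2)%:C%:M.
Proof.
apply/matrixP => j k; rewrite !ord1 !mxE mulr1n sqr_norm2 rmorph_sum.
by apply: eq_bigr => i _; rewrite !mxE mulrC mulC_conj.
Qed.

Lemma sqr_norm2Z n z (v : 'cV[R[i]]_n) :
  norm2 (z *: v) ^+ 2 = Normc.normc z ^+ 2 * norm2 v ^+ 2.
Proof.
rewrite !sqr_norm2 mulr_sumr; apply: eq_bigr => i _.
by rewrite mxE Normc.normcM exprMn.
Qed.

Lemma norm2_gt0 n (v : 'cV[R[i]]_n) : v != 0 -> 0 < norm2 v.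
Proof.
move=> v0; rewrite sqrtr_gt0 lt_neqAle sumr_ge0 ?andbT; last first.
  by move=> i _; rewrite sqr_ge0.
apply: contra v0 => /eqP/esym v0; apply/eqP/matrixP => i j.
rewrite (ord1 j) mxE; apply: Normc.eq0_normc; apply/eqP.
rewrite -sqrf_eq0; apply/eqP/(psumr_eq0P _ v0) => // k _.
exact: sqr_ge0.
Qed.

Lemma Cauchy_Schwarz_norm2 n (u v : 'cV[R[i]]_n) :
  Normc.normc (scalar_of (u^t* *m v)) ^+ 2 <= norm2 u ^+ 2 * norm2 v ^+ 2.
Proof.
(* [dotmx] pairs row vectors by [u *m v^t*], so it is applied to the adjoints of the two columns;
   [lecR] brings the complex inequality back to the reals. *)
have [+ _] := CauchySchwarz (@dotmx _ n) (u^t*) (v^t*).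
rewrite /= !dotmxE !adjmxK !adjmx_mul_norm2 !scalar_mx11E -rmorphM -lecR.
by rewrite [in X in _ -> X]rmorphXn.
Qed.

Lemma trace_adjmx m n (F : 'M[R[i]]_(m, n)) :
  \tr (F *m F^t*) = (\sum_(j < n) norm2 (col j F) ^+ 2)%:C.
Proof.
rewrite mxtrace_mulC rmorph_sum; apply: eq_bigr => j _.
rewrite mxE sqr_norm2 rmorph_sum; apply: eq_bigr => i _.
by rewrite !mxE mulrC mulC_conj.
Qed.

(** Entry [j] of [F^t* *m h] is the inner product of column [j] of [F] with [h]; Cauchy-Schwarz
    applies to each entry. *)
Lemma sqr_norm2_adjmx_mul m n (F : 'M[R[i]]_(m, n)) (h : 'cV[R[i]]_m) :
  norm2 (F^t* *m h) ^+ 2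
    <= norm2 h ^+ 2 * \sum_(j < n) norm2 (col j F) ^+ 2.
Proof.
rewrite [leLHS]sqr_norm2 mulr_sumr; apply: ler_sum => j _; rewrite mulrC.
suff -> : (F^t* *m h) j 0 = scalar_of ((col j F)^t* *m h).
  exact: Cauchy_Schwarz_norm2.
by rewrite /scalar_of !mxE; apply: eq_bigr => i _; rewrite !mxE.
Qed.

(** The matrix under the trace splits as F F^H + P (F h_r)(F h_r)^H, and both traces are real, so
    the complex order reduces to that of [R]. *)
Lemma power_feasibleE n (hr : 'cV[R[i]]_n) P Pr (F : 'M[R[i]]_n) :
  power_feasible hr P Pr F <->
  \sum_(j < n) norm2 (col j F) ^+ 2 + P * norm2 (F *m hr) ^+ 2 <= Pr.
Proof.
rewrite /power_feasible mulmxDr mulmx1 mulmxDl raddfD /= trace_adjmx.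
rewrite -scalemxAr -scalemxAl mxtraceZ.
have -> : F *m (hr *m hr^t*) *m F^t* = (F *m hr) *m (F *m hr)^t*.
  by rewrite adjmxM !mulmxA.
by rewrite mxtrace_mulC adjmx_mul_norm2 mxtrace_scalar mulr1n
  -rmorphM -rmorphD lecR.
Qed.

(** With s = h^H F h_r, the numerator is P s s^H and the denominator is 1 + |F^H h|^2: both are
    real, so [complex.Re] disappears. *)
Lemma rateE n (hr h : 'cV[R[i]]_n) (hd : R[i]) P (F : 'M[R[i]]_n) :
  rate hr h hd P F =
  log2 (1 + Normc.normc hd ^+ 2 * P +
        P * Normc.normc (scalar_of (h^t* *m (F *m hr))) ^+ 2
        / (1 + norm2 (F^t* *m h) ^+ 2)).
Proof.
rewrite /rate; congr (log2 (_ + _)).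
have -> : h^t* *m F *m F^t* *m h = (norm2 (F^t* *m h) ^+ 2)%:C%:M.
  by rewrite -adjmx_mul_norm2 adjmxM adjmxK !mulmxA.
have -> : h^t* *m F *m (P%:C *: (hr *m hr^t*)) *m F^t* *m h =
    P%:C *: ((h^t* *m (F *m hr)) *m (h^t* *m (F *m hr))^t*).
  by rewrite !adjmxM adjmxK -scalemxAr -!scalemxAl !mulmxA.
set s := h^t* *m (F *m hr).
have -> : scalar_of (P%:C *: (s *m s^t*)) =
    (P * Normc.normc (scalar_of s) ^+ 2)%:C.
  rewrite /scalar_of mxE [X in _ * X]mxE big_ord1 !mxE mulC_conj.
  by rewrite -rmorphM.
rewrite /scalar_of scalar_mx11E -(rmorph1 (real_complex R)) -rmorphD.
by rewrite -fmorphV -rmorphM.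
Qed.

(** The right-hand side is the value at the point where both constraints are tight, a = H Pr / (1 +
    G P) and x = a G. Clearing denominators leaves P times an inequality linear in (a, x). *)
Lemma snr_le (G H a x P Pr : R) : 0 <= G -> 0 <= H -> 0 <= a -> 0 <= P ->
  0 <= Pr -> x <= a * G -> a + P * x <= H * Pr ->
  P * x / (1 + a) <= H * G * P * Pr / (1 + H * Pr + G * P).
Proof.
move=> G0 H0 a0 P0 Pr0 xaG axH.
have HPr0 : 0 <= H * Pr by rewrite mulr_ge0.
have GP0 : 0 <= G * P by rewrite mulr_ge0.
rewrite ler_pdivrMr; last by lra.
rewrite mulrAC ler_pdivlMr; last by lra.
(* the sum of x <= a G, x H Pr <= a G H Pr and x G P <= G (H Pr - a) *)
have key : x * (1 + H * Pr + G * P) <= H * G * Pr * (1 + a).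
  have e1 := ler_wpM2r HPr0 xaG.
  have e2 := ler_wpM2l G0 axH.
  lra.
have := ler_wpM2l P0 key.
lra.
Qed.

Lemma ler_log2 x y : 0 < x -> x <= y -> log2 x <= log2 y.
Proof.
move=> x0 xy; rewrite ler_wpM2r ?invr_ge0 ?ln_ge0 ?ler1n //.
by rewrite ler_ln // posrE // (lt_le_trans x0).
Qed.

Section RankOne.
Variables (n : nat) (hr h : 'cV[R[i]]_n) (d : R).
(** The real scale [d] stays free: power and rate depend on it only through [d ^+ 2]. *)
Let F := d%:C *: (h *m hr^t*).

Lemma rank1_mul : F *m hr = (d * norm2 hr ^+ 2)%:C *: h.
Proof.
by rewrite -scalemxAl -mulmxA adjmx_mul_norm2 mul_mx_scalar scalerA -rmorphM.
Qed.

Lemma rank1_adj_mul : F^t* *m h = (d * norm2 h ^+ 2)%:C *: hr.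
Proof.
rewrite adjmxZ conjC_real adjmxM adjmxK -scalemxAl -mulmxA adjmx_mul_norm2.
by rewrite mul_mx_scalar scalerA -rmorphM.
Qed.

Lemma rank1_sum_col :
  \sum_(j < n) norm2 (col j F) ^+ 2 = d ^+ 2 * norm2 h ^+ 2 * norm2 hr ^+ 2.
Proof.
rewrite [norm2 hr ^+ 2]sqr_norm2 mulr_sumr; apply: eq_bigr => j _.
have -> : col j F = (d%:C * Num.conj (hr j 0)) *: h.
  by apply/matrixP => i k; rewrite (ord1 k) !mxE big_ord1 !mxE; ring.
by rewrite sqr_norm2Z Normc.normcM exprMn normc_real normc_conj; ring.
Qed.

Lemma rank1_sqr_gain :
  Normc.normc (scalar_of (h^t* *m (F *m hr))) ^+ 2 =
  (d * norm2 hr ^+ 2 * norm2 h ^+ 2) ^+ 2.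
Proof.
rewrite rank1_mul -scalemxAr adjmx_mul_norm2 /scalar_of !mxE mulr1n.
by rewrite -rmorphM normc_real.
Qed.

End RankOne.

Lemma opt_relayE n (hr h : 'cV[R[i]]_n) P Pr :
  opt_relay hr h P Pr =
  (Num.sqrt (Pr / (1 + norm2 hr ^+ 2 * P)) / (norm2 h * norm2 hr))%:C
    *: (h *m hr^t*).
Proof. by rewrite /opt_relay scalerA -fmorphV -rmorphM. Qed.

End RelayChannel.

Theorem mainTheorem4 (R : realType) (Mr : nat) (hMr : (1 <= Mr)%N)
    (hr h : 'cV[R[i]]_Mr) (hd : R[i]) (P Pr : R)
    (hP : 0 <= P) (hPr : 0 < Pr) (h_neq0 : h != 0) (hr_neq0 : hr != 0) :
  [/\ power_feasible hr P Pr (opt_relay hr h P Pr),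
      (forall F : 'M[R[i]]_Mr, power_feasible hr P Pr F ->
         rate hr h hd P F <= rate hr h hd P (opt_relay hr h P Pr))
    & rate hr h hd P (opt_relay hr h P Pr) =
        log2 (1 + Normc.normc hd ^+ 2 * P +
              norm2 h ^+ 2 * norm2 hr ^+ 2 * P * Pr
              / (1 + norm2 h ^+ 2 * Pr + norm2 hr ^+ 2 * P))].
Proof.
have H0 := norm2_gt0 h_neq0; have G0 := norm2_gt0 hr_neq0.
set H := norm2 h in H0 *; set G := norm2 hr in G0 *.
have GP0 : 0 <= G ^+ 2 * P by rewrite mulr_ge0 ?sqr_ge0.
have HPr0 : 0 <= H ^+ 2 * Pr by rewrite mulr_ge0 ?sqr_ge0 // ltW.
have GP1 : 0 < 1 + G ^+ 2 * P by lra.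
set d := Num.sqrt (Pr / (1 + G ^+ 2 * P)) / (H * G).
have optE : opt_relay hr h P Pr = d%:C *: (h *m hr^t*) by exact: opt_relayE.
have d2 : d ^+ 2 = Pr / ((1 + G ^+ 2 * P) * H ^+ 2 * G ^+ 2).
  rewrite expr_div_n sqr_sqrtr ?divr_ge0 ?ltW //; field.
  by rewrite !gt_eqF.
(* Only [d2] is needed from now on, so the square root is forgotten and [field] sees rational
   expressions. *)
clearbody d.
have rate_opt : rate hr h hd P (opt_relay hr h P Pr) =
    log2 (1 + Normc.normc hd ^+ 2 * P +
          H ^+ 2 * G ^+ 2 * P * Pr / (1 + H ^+ 2 * Pr + G ^+ 2 * P)).
  rewrite rateE optE rank1_sqr_gain rank1_adj_mul sqr_norm2Z normc_real.
  rewrite -/H -/G !exprMn d2; congr (log2 (_ + _)); field.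
  rewrite !gt_eqF //=; lra.
split; [| |exact: rate_opt].
- apply/power_feasibleE.
  rewrite optE rank1_sum_col rank1_mul sqr_norm2Z normc_real -/H -/G.
  (* The power budget is spent exactly: d^2 H^2 G^2 (1 + G^2 P) = Pr. *)
  rewrite !exprMn d2 le_eqVlt; apply/orP; left; apply/eqP; field.
  by rewrite !gt_eqF.
- move=> F /power_feasibleE; rewrite rate_opt rateE.
  set S := \sum_(j < Mr) _ => feas.
  apply: ler_log2; last rewrite lerD2l.
    rewrite -addrA ltr_wpDr //; apply: addr_ge0.
      by rewrite mulr_ge0 ?sqr_ge0.
    apply: divr_ge0; first by rewrite mulr_ge0 ?sqr_ge0.
    by apply: addr_ge0; rewrite ?sqr_ge0.
  apply: snr_le; rewrite ?sqr_ge0 // ?(ltW hPr) //.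
  (* Here h^H F h_r is read as the inner product of F^H h with h_r. *)
  + have -> : h^t* *m (F *m hr) = (F^t* *m h)^t* *m hr.
      by rewrite adjmxM adjmxK mulmxA.
    exact: Cauchy_Schwarz_norm2.
  (* The power constraint is scaled by |h|^2 and bounded term by term; now h^H F h_r is the inner
     product of h with F h_r. *)
  + apply: le_trans (ler_wpM2l (sqr_ge0 H) feas).
    rewrite mulrDr [H ^+ 2 * (P * _)]mulrCA.
    apply: lerD; first exact: sqr_norm2_adjmx_mul.
    by apply: ler_wpM2l => //; exact: Cauchy_Schwarz_norm2.
Qed.
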